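(* The algorithm described in the context for the single-constraint single-variable problem $$\text{minimize } Z(\mathbf y)=y\quad\text{subject to}\quad T_L(a_{i1},y)+\cdots+T_L(a_{in},y)\ge b_i,\ y\in[0,1],$$ terminates after $O(n^2)$ operations.
   Context: Fix $i$. Let $J=\{1,\dots,n\}$, $a_{i1},\dots,a_{in}\in[0,1]$ and $b_i>0$ real. The Łukasiewicz t-norm is $T_L(a,x)=\max\{a+x-1,0\}$ on $[0,1]^2$. Let $\mathbf y=(y,\dots,y)$ and $S^i(A,b)=\{(y,\dots,y)\in[0,1]^n : \sum_{j\in J}T_L(a_{ij},y)\ge b_i\}$. For $\mathbf u=(u,\dots,u)$ let $J(\mathbf u)=\{j\in J : u\ge 1-a_{ij}\}$. Algorithm (input $a_{i1},\dots,a_{in},b_i$; output $\mathbf u^k$). Step 1: check solvability; if $S^i(A,b)=\emptyset$, stop. Step 2: compute $\mathbf u^0=(u^0,\dots,u^0)$ with $u^0=\frac{b_i-\sum_{j\in J}a_{ij}}{n}+1$; set $k:=0$. Step 3: compute $J(\mathbf u^k)$; if $\sum_{j\in J(\mathbf u^k)}T_L(a_{ij},u^k)=b_i$, go to Step 6. Step 4: set $k:=k+1$ and compute $\mathbf u^k=(u^k,\dots,u^k)$ with $u^k=\frac{b_i-\sum_{j\in J(\mathbf u^{k-1})}a_{ij}}{|J(\mathbf u^{k-1})|}+1$. Step 5: compute $J(\mathbf u^k)$; if $J(\mathbf u^k)\subsetneq J(\mathbf u^{k-1})$, go to Step 4. Step 6: output $\mathbf u^k$. Operations are elementary operations on real numbers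 (arithmetic operations and comparisons). *)

(* Defs.v *)
From HB Require Import structures.
From mathcomp Require Import all_boot all_order all_algebra.
From mathcomp Require Import reals.

Set Implicit Arguments.
Unset Strict Implicit.
Unset Printing Implicit Defensive.

Import Order.TTheory GRing.Theory Num.Theory.
Local Open Scope ring_scope.

(** * The mathematical problem

    The index i of the constraint is fixed, so that row i of the matrix is a
    tuple [a] and its right-hand side a scalar [b].  A constant vector
    (y, ..., y) is represented by the scalar y. *)

Definition TL (R : realType) (x y : R) : R := Num.max (x + y - 1) 0.

Definition feasible (R : realType) (n : nat) (a : n.-tuple R) (b y : R) : Prop :=
  0 <= y <= 1 /\ b <= \sum_(j < n) TL (tnth a j) y.

Definition Jset (R : realType) (n : nat) (a : n.-tuple R) (u : R) : {set 'I_n} :=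
  [set j | 1 - tnth a j <= u].

(** * A machine that counts elementary operations on real numbers

    A program is written for abstract types [V] of numbers and [B] of stored
    truth values.  Code polymorphic in [V] and [B] can only obtain a number
    from the input, the literals 0 and 1, or an [Arith] operation, and can only
    depend on the value of numbers by a [Compare] followed by a [Branch]; hence
    no operation on numbers escapes the count. *)

Inductive arith_op := Add | Sub | Mul | Div.
Inductive comparison_op := Leq | Equal.

Inductive prog (V B A : Type) : Type :=
| Ret of A
| Literal of bool & (V -> prog V B A)
| Arith of arith_op & V & V & (V -> prog V B A)
| Compare of comparison_op & V & V & (B -> prog V B A)
| Branch of B & (bool -> prog V B A).

Arguments Ret {V B A}.
Arguments Literal {V B A}.
Arguments Arith {V B A}.
Arguments Compare {V B A}.
Arguments Branch {V B A}.

Fixpoint bind {V B A A' : Type} (p : prog V B A) (f : A -> prog V B A') :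
    prog V B A' :=
  match p with
  | Ret x => f x
  | Literal l k => Literal l (fun v => bind (k v) f)
  | Arith o x y k => Arith o x y (fun v => bind (k v) f)
  | Compare o x y k => Compare o x y (fun t => bind (k t) f)
  | Branch t k => Branch t (fun c => bind (k c) f)
  end.

Notation "'let*' x := p 'in' q" := (bind p (fun x => q))
  (at level 200, x name, p at level 100, q at level 200, right associativity).

Definition eval_arith (R : realType) (o : arith_op) (x y : R) : option R :=
  match o with
  | Add => Some (x + y)
  | Sub => Some (x - y)
  | Mul => Some (x * y)
  | Div => if y == 0 then None else Some (x / y)
  end.

Definition eval_comparison (R : realType) (o : comparison_op) (x y : R) : bool :=
  match o with Leq => x <= y | Equal => x == y end.

(* The result of a program and the number of operations executed; [None] means
   that the program is stuck on a division by zero.  Each arithmetic operation,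
   each comparison and each test of a stored truth value costs 1. *)
Fixpoint exec (R : realType) (A : Type) (p : prog R bool A) : option (A * nat) :=
  let charge := omap (fun r : A * nat => (r.1, r.2.+1)) in
  match p with
  | Ret x => Some (x, 0%N)
  | Literal l k => exec (k (if l then 1 else 0))
  | Arith o x y k =>
      if eval_arith o x y is Some v then charge (exec (k v)) else None
  | Compare o x y k => charge (exec (k (eval_comparison o x y)))
  | Branch t k => charge (exec (k t))
  end.

Definition zero {V B : Type} : prog V B V := Literal false Ret.
Definition one {V B : Type} : prog V B V := Literal true Ret.
Definition arith {V B : Type} (o : arith_op) (x y : V) : prog V B V :=
  Arith o x y Ret.
Definition compare {V B : Type} (o : comparison_op) (x y : V) : prog V B B :=
  Compare o x y Ret.
Definition branch {V B : Type} (t : B) : prog V B bool := Branch t Ret.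

(** * The algorithm

    A subset of J is stored as the sequence of the truth values of the
    memberships of 1, ..., n. *)

Fixpoint sum_prog {V B : Type} (s : seq V) : prog V B V :=
  if s is x :: s' then let* r := sum_prog s' in arith Add x r else zero.

Fixpoint count_prog {V B : Type} (s : seq V) : prog V B V :=
  if s is _ :: s' then
    let* r := count_prog s' in let* e := one in arith Add r e
  else zero.

(* The entries a_j for j in the stored subset [J] *)
Fixpoint select_prog {V B : Type} (J : seq B) (s : seq V) : prog V B (seq V) :=
  match J, s with
  | t :: J', x :: s' =>
      let* r := select_prog J' s' in
      let* inJ := branch t in
      Ret (if inJ then x :: r else r)
  | _, _ => Ret [::]
  end.

Definition TL_prog {V B : Type} (x y : V) : prog V B V :=
  let* s := arith Add x y in
  let* e := one in
  let* d := arith Sub s e in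
  let* z := zero in
  let* t := compare Leq d z in
  let* nonpos := branch t in
  Ret (if nonpos then z else d).

Fixpoint TLs_prog {V B : Type} (s : seq V) (u : V) : prog V B (seq V) :=
  if s is x :: s' then
    let* r := TLs_prog s' u in let* v := TL_prog x u in Ret (v :: r)
  else Ret [::].

Fixpoint Jset_prog {V B : Type} (s : seq V) (u : V) : prog V B (seq B) :=
  if s is x :: s' then
    let* r := Jset_prog s' u in
    let* e := one in
    let* d := arith Sub e x in
    let* t := compare Leq d u in
    Ret (t :: r)
  else Ret [::].

Fixpoint subset_prog {V B : Type} (J1 J2 : seq B) : prog V B bool :=
  match J1, J2 with
  | t1 :: J1', t2 :: J2' =>
      let* in1 := branch t1 in
      let* in2 := branch t2 in
      if in1 then (if in2 then subset_prog J1' J2' else Ret false)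
      else subset_prog J1' J2'
  | _, _ => Ret true
  end.

Definition proper_prog {V B : Type} (J1 J2 : seq B) : prog V B bool :=
  let* s12 := subset_prog J1 J2 in
  if s12 then let* s21 := subset_prog J2 J1 in Ret (~~ s21) else Ret false.

(* (b - sum of s) / (length of s) + 1 *)
Definition candidate_prog {V B : Type} (s : seq V) (b : V) : prog V B V :=
  let* r := sum_prog s in
  let* d := arith Sub b r in
  let* m := count_prog s in
  let* q := arith Div d m in
  let* e := one in
  arith Add q e.

(* T_L is nondecreasing in its second argument, so the feasible set is nonempty
   iff it contains (1, ..., 1): see [solvable_progE]. *)
Definition solvable_prog {V B : Type} (s : seq V) (b : V) : prog V B bool :=
  let* e := one in
  let* ts := TLs_prog s e in
  let* r := sum_prog ts in
  let* t := compare Leq b r in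
  branch t.

(* The control points are the steps of the algorithm, with the current u^k and
   the stored set J(u^k) (at [Step4], after which k is incremented) or
   J(u^(k-1)) (at [Step5]).  [Infeasible] is the stop in Step 1, and [Step6 u]
   outputs u. *)
Inductive state (V B : Type) : Type :=
| Infeasible
| Step1
| Step2
| Step3 of V
| Step4 of seq B
| Step5 of V & seq B
| Step6 of V.

Arguments Infeasible {V B}.
Arguments Step1 {V B}.
Arguments Step2 {V B}.
Arguments Step3 {V B}.
Arguments Step4 {V B}.
Arguments Step5 {V B}.
Arguments Step6 {V B}.

Definition halted {V B : Type} (s : state V B) : bool :=
  match s with Infeasible | Step6 _ => true | _ => false end.

Definition transition {V B : Type} (a : seq V) (b : V) (s : state V B) :
    prog V B (state V B) :=
  match s with
  | Step1 =>
      let* ok := solvable_prog a b in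
      Ret (if ok then Step2 else Infeasible)
  | Step2 =>
      let* u0 := candidate_prog a b in
      Ret (Step3 u0)
  | Step3 u =>
      let* J := Jset_prog a u in
      let* aJ := select_prog J a in
      let* ts := TLs_prog aJ u in
      let* r := sum_prog ts in
      let* t := compare Equal r b in
      let* tight := branch t in
      Ret (if tight then Step6 u else Step4 J)
  | Step4 J =>
      let* aJ := select_prog J a in
      let* u := candidate_prog aJ b in
      Ret (Step5 u J)
  | Step5 u Jprev =>
      let* J := Jset_prog a u in
      let* smaller := proper_prog J Jprev in
      Ret (if smaller then Step4 J else Step6 u)
  | Infeasible | Step6 _ => Ret s
  end.

(* The state after m transitions and the total number of operations *)
Fixpoint run (R : realType) (a : seq R) (b : R) (m : nat) (s : state R bool) :
    option (state R bool * nat) :=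
  if m is m'.+1 then
    if exec (transition a b s) is Some (s', c) then
      omap (fun r : state R bool * nat => (r.1, (c + r.2)%N)) (run a b m' s')
    else None
  else Some (s, 0%N).

(** * The machine code computes what the algorithm prescribes *)

Definition result (R : realType) (A : Type) (p : prog R bool A) : option A :=
  omap fst (exec p).

Definition flags (n : nat) (J : {set 'I_n}) : seq bool :=
  [seq j \in J | j <- enum 'I_n].

Lemma result_bind (R : realType) (A A' : Type) (p : prog R bool A)
    (f : A -> prog R bool A') :
  result (bind p f) = obind (fun x => result (f x)) (result p).
Proof.
rewrite /result; elim: p => [x|l k IH|o x y k IH|o x y k IH|t k IH] //=.
- case: (eval_arith o x y) => //= v; move: (IH v).
  by case: (exec (k v)) => [[]|] /=; case: (exec (bind _ _)) => [[]|].
- move: (IH (eval_comparison o x y)).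
  by case: (exec (k _)) => [[]|] /=; case: (exec (bind _ _)) => [[]|].
- move: (IH t).
  by case: (exec (k _)) => [[]|] /=; case: (exec (bind _ _)) => [[]|].
Qed.

Lemma result_arith (R : realType) (A : Type) (o : arith_op) (x y : R)
    (k : R -> prog R bool A) :
  result (Arith o x y k) = obind (fun v => result (k v)) (eval_arith o x y).
Proof.
by rewrite /result /=; case: eval_arith => //= v; case: exec => [[]|].
Qed.

Lemma sum_progE (R : realType) (s : seq R) :
  result (sum_prog s) = Some (\sum_(x <- s) x).
Proof.
elim: s => [|x s IH]; first by rewrite big_nil.
by rewrite big_cons /= result_bind IH.
Qed.

Lemma count_progE (R : realType) (s : seq R) :
  result (count_prog s) = Some (size s)%:R.
Proof. by elim: s => [|x s IH] //; rewrite /= result_bind IH /= -natr1. Qed.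

Lemma TL_progE (R : realType) (x y : R) : result (TL_prog x y) = Some (TL x y).
Proof. by rewrite /TL /result /=; case: leP. Qed.

Lemma TLs_progE (R : realType) (s : seq R) (u : R) :
  result (TLs_prog s u) = Some [seq TL x u | x <- s].
Proof.
elim: s => [|x s IH] //.
by rewrite /= result_bind IH /= /TL /result /=; case: leP.
Qed.

Lemma tuple_map (R : realType) (n : nat) (a : n.-tuple R) :
  val a = [seq tnth a j | j <- enum 'I_n].
Proof. by rewrite map_tnth_enum. Qed.

Lemma Jset_progE (R : realType) (n : nat) (a : n.-tuple R) (u : R) :
  result (Jset_prog a u) = Some (flags (Jset a u)).
Proof.
rewrite {1}tuple_map /flags; elim: (enum 'I_n) => [|j s IH] //.
by rewrite /= result_bind IH /= /result /= inE.
Qed.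

Lemma select_progE (R : realType) (n : nat) (a : n.-tuple R) (J : {set 'I_n}) :
  result (select_prog (flags J) a) = Some [seq tnth a j | j <- enum J].
Proof.
have -> : enum J = [seq j <- enum 'I_n | j \in J] by rewrite enumT.
rewrite tuple_map /flags.
elim: (enum 'I_n) => [|j s IH] //.
rewrite /= result_bind IH /= /result /=.
by case: (j \in J).
Qed.

Lemma subset_progE (R : realType) (n : nat) (J1 J2 : {set 'I_n}) :
  result (subset_prog (flags J1) (flags J2) : prog R bool bool)
  = Some (J1 \subset J2).
Proof.
have -> : (J1 \subset J2) = all (fun j => (j \in J1) ==> (j \in J2)) (enum 'I_n).
  apply/subsetP/allP => [H j _|H j j1]; first by apply/implyP/H.
  by move: (H j); rewrite mem_enum j1 => /(_ isT).
rewrite /flags; elim: (enum 'I_n) => [|j s IH] //=.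
rewrite /result /=.
by case: (j \in J1); case: (j \in J2) => //=;
  rewrite -IH /result; case: exec => [[]|].
Qed.

Lemma proper_progE (R : realType) (n : nat) (J1 J2 : {set 'I_n}) :
  result (proper_prog (flags J1) (flags J2) : prog R bool bool)
  = Some (J1 \proper J2).
Proof.
rewrite /proper_prog result_bind subset_progE /= properE; case: (J1 \subset J2) => //.
by rewrite result_bind subset_progE.
Qed.

Lemma solvable_progE (R : realType) (n : nat) (a : n.-tuple R) (b : R) :
  exists2 t, result (solvable_prog a b) = Some t
  & t <-> exists y, feasible a b y.
Proof.
exists (b <= \sum_(j < n) TL (tnth a j) 1).
  rewrite /solvable_prog result_bind /= result_bind TLs_progE /= result_bind.
  by rewrite sum_progE /= tuple_map !big_map -enumT big_enum.
split=> [h|[y [/andP[_ y1] h]]]; first by exists 1; rewrite /feasible ler01 lexx.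
apply: (le_trans h); apply: ler_sum => j _.
by rewrite /TL ge_max !le_max lexx orbT lerD2r lerD2l y1.
Qed.

Lemma candidate_progE (R : realType) (s : seq R) (b : R) :
  s != [::] ->
  result (candidate_prog s b) = Some ((b - \sum_(x <- s) x) / (size s)%:R + 1).
Proof.
move=> s0; rewrite /candidate_prog result_bind sum_progE /= result_arith /=.
rewrite result_bind count_progE /= /result /= pnatr_eq0.
by rewrite size_eq0 (negPf s0).
Qed.

Lemma transition_step1 (R : realType) (n : nat) (a : n.-tuple R) (b : R) :
  exists2 t, result (transition a b Step1) = Some (if t then Step2 else Infeasible)
  & t <-> exists y, feasible a b y.
Proof.
have [t ht tP] := solvable_progE a b; exists t => //.
by rewrite /transition result_bind ht.
Qed.

Lemma transition_step2 (R : realType) (n : nat) (a : n.-tuple R) (b : R) :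
  (0 < n)%N ->
  result (transition a b Step2)
  = Some (Step3 ((b - \sum_(j < n) tnth a j) / n%:R + 1)).
Proof.
move=> n0; rewrite /transition result_bind candidate_progE; last first.
  by rewrite -size_eq0 size_tuple -lt0n.
by rewrite /= size_tuple tuple_map big_map big_enum.
Qed.

Lemma transition_step3 (R : realType) (n : nat) (a : n.-tuple R) (b u : R) :
  result (transition a b (Step3 u))
  = Some (if \sum_(j in Jset a u) TL (tnth a j) u == b then Step6 u
          else Step4 (flags (Jset a u))).
Proof.
rewrite /transition result_bind Jset_progE /= result_bind select_progE /=.
rewrite result_bind TLs_progE /= result_bind sum_progE /=.
by rewrite !big_map big_enum.
Qed.

Lemma transition_step4 (R : realType) (n : nat) (a : n.-tuple R) (b : R)
    (J : {set 'I_n}) :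
  J != set0 ->
  result (transition a b (Step4 (flags J)))
  = Some (Step5 ((b - \sum_(j in J) tnth a j) / #|J|%:R + 1) (flags J)).
Proof.
move=> J0; rewrite /transition result_bind select_progE /= result_bind.
rewrite candidate_progE; last by rewrite -size_eq0 size_map -cardE cards_eq0.
by rewrite /= size_map -cardE big_map big_enum.
Qed.

Lemma transition_step5 (R : realType) (n : nat) (a : n.-tuple R) (b u : R)
    (J : {set 'I_n}) :
  result (transition a b (Step5 u (flags J)))
  = Some (if Jset a u \proper J then Step4 (flags (Jset a u)) else Step6 u).
Proof.
by rewrite /transition result_bind Jset_progE /= result_bind proper_progE.
Qed.

(* Main.v *)
Require Import Defs.
From mathcomp Require Import all_boot all_order all_algebra.
From mathcomp Require Import reals.
From mathcomp Require Import zify.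

(** Every transition costs [O(n)] operations, and every return to Step 4 strictly
    shrinks the stored subset of [J], so there are [O(n)] transitions.  The
    machine never divides by zero: if [u] is computed from a nonempty set [K],
    then the terms [a_j + u - 1] for [j] in [K] add up to [b > 0], so one of them
    is nonnegative and [J(u)] is again nonempty. *)

Set Implicit Arguments.
Unset Strict Implicit.
Unset Printing Implicit Defensive.

Import Order.TTheory GRing.Theory Num.Theory.
Local Open Scope ring_scope.

(** * Rules for bounding operation counts *)

(* Programs that get stuck satisfy every bound. *)
Definition cost_le (R : realType) (A : Type) (p : prog R bool A) (k : nat) :=
  if exec p is Some (_, c) then (c <= k)%N else true.

(** Counts add along sequential composition. [result_bind] discards the counts, so this finer form
    is what cost bounds rest on. *)
Lemma exec_bind (R : realType) (A A' : Type) (p : prog R bool A)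
    (f : A -> prog R bool A') :
  exec (bind p f) =
  if exec p is Some (x, c) then omap (fun r => (r.1, (c + r.2)%N)) (exec (f x))
  else None.
Proof.
elim: p => [x|l k IH|o x y k IH|o x y k IH|t k IH] //=.
- by case: (exec (f x)) => [[]|].
- case: (eval_arith o x y) => //= v; rewrite IH.
  by case: (exec (k v)) => [[z c]|] //=; case: (exec (f z)) => [[]|].
- rewrite IH; case: (exec _) => [[z c]|] //=.
  by case: (exec (f z)) => [[]|].
- rewrite IH; case: (exec _) => [[z c]|] //=.
  by case: (exec (f z)) => [[]|].
Qed.

Section Costs.
Variable R : realType.
Implicit Types (s : seq R) (u b : R).

Lemma cost_le_weaken A (p : prog R bool A) k k' :
  cost_le p k -> (k <= k')%N -> cost_le p k'.
Proof. by rewrite /cost_le; case: (exec p) => [[x c]|] //; apply: leq_trans. Qed.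

(** The continuation is bounded only at the value that [p] really returns. Correctness lemmas can
    thus supply the lengths of intermediate lists. *)
Lemma cost_le_bind A A' (p : prog R bool A) (f : A -> prog R bool A') k k' :
  cost_le p k -> (forall x, result p = Some x -> cost_le (f x) k') ->
  cost_le (bind p f) (k + k').
Proof.
rewrite /cost_le exec_bind /result; case: (exec p) => [[x c]|] //= ck.
by move=> /(_ x erefl); case: (exec (f x)) => [[z d]|] //=; apply: leq_add.
Qed.

Lemma cost_le_ret A (x : A) k : cost_le (Ret x : prog R bool A) k.
Proof. by []. Qed.

Lemma cost_le_literal A l (f : R -> prog R bool A) k :
  (forall x, cost_le (f x) k) -> cost_le (Literal l f) k.
Proof. by move=> fk; apply: fk. Qed.

Lemma cost_le_arith A o (x y : R) (f : R -> prog R bool A) k :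
  (forall z, cost_le (f z) k) -> cost_le (Arith o x y f) k.+1.
Proof.
move=> fk; rewrite /cost_le /=; case: (eval_arith o x y) => // v.
by move: (fk v); rewrite /cost_le; case: (exec (f v)) => [[]|].
Qed.

Lemma cost_le_compare A o (x y : R) (f : bool -> prog R bool A) k :
  (forall t, cost_le (f t) k) -> cost_le (Compare o x y f) k.+1.
Proof.
move=> /(_ (eval_comparison o x y)); rewrite /cost_le /=.
by case: (exec (f _)) => [[]|].
Qed.

Lemma cost_le_branch A t (f : bool -> prog R bool A) k :
  (forall t, cost_le (f t) k) -> cost_le (Branch t f) k.+1.
Proof. by move=> /(_ t); rewrite /cost_le /=; case: (exec (f t)) => [[]|]. Qed.

Ltac cost_tac :=
  repeat first [ exact: cost_le_ret | apply: cost_le_literal => ?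
               | apply: cost_le_arith => ? | apply: cost_le_compare => ?
               | apply: cost_le_branch => ? ].

(** * Linear costs of the subroutines *)

Lemma cost_sum_prog s : cost_le (sum_prog s) (size s).
Proof.
elim: s => [|x s IH] /=; first by cost_tac.
by rewrite -addn1; apply: cost_le_bind => // r _; cost_tac.
Qed.

Lemma cost_count_prog s : cost_le (count_prog s) (size s).
Proof.
elim: s => [|x s IH] /=; first by cost_tac.
by rewrite -addn1; apply: cost_le_bind => // r _; cost_tac.
Qed.

Lemma cost_select_prog (J : seq bool) s : cost_le (select_prog J s) (size s).
Proof.
elim: J s => [|t J IH] [|x s] /=; try exact: cost_le_ret.
by rewrite -addn1; apply: cost_le_bind => // r _; cost_tac.
Qed.

Lemma cost_TL_prog (x y : R) : cost_le (TL_prog x y) 4.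
Proof. by rewrite /TL_prog /=; cost_tac. Qed.

Lemma cost_TLs_prog s u : cost_le (TLs_prog s u) (4 * size s).
Proof.
elim: s => [|x s IH]; first exact: cost_le_ret.
rewrite [size _]/= mulnSr; apply: cost_le_bind => [//|r _].
rewrite -[4%N]addn0; apply: cost_le_bind => [|v _]; first exact: cost_TL_prog.
exact: cost_le_ret.
Qed.

Lemma cost_Jset_prog s u : cost_le (Jset_prog s u) (2 * size s).
Proof.
elim: s => [|x s IH]; first exact: cost_le_ret.
rewrite [size _]/= mulnSr; apply: cost_le_bind => [//|r _ /=].
by cost_tac.
Qed.

(** Each position costs two branches. Stopping early, at a failed inclusion or at the end of the
    shorter list, only lowers the count. *)
Lemma cost_subset_prog (J1 J2 : seq bool) :
  cost_le (subset_prog J1 J2 : prog R bool bool) (2 * size J1).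
Proof.
elim: J1 J2 => [|t1 J1 IH] [|t2 J2]; try exact: cost_le_ret.
rewrite [size _]/= mulnS /=.
apply: cost_le_branch => -[]; apply: cost_le_branch => -[]; try exact: IH.
exact: cost_le_ret.
Qed.

Lemma cost_proper_prog (J1 J2 : seq bool) :
  cost_le (proper_prog J1 J2 : prog R bool bool) (2 * size J1 + 2 * size J2).
Proof.
apply: cost_le_bind => [|[] _]; first exact: cost_subset_prog.
  rewrite -[X in cost_le _ X]addn0.
  apply: cost_le_bind => [|t _]; first exact: cost_subset_prog.
  exact: cost_le_ret.
exact: cost_le_ret.
Qed.

(** Summing and counting cost one addition per entry each; the constant 3 is the subtraction, the
    division and the final addition. *)
Lemma cost_candidate_prog s b : cost_le (candidate_prog s b) (2 * size s + 3).
Proof.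
rewrite (_ : 2 * size s + 3 = size s + (size s + 2).+1)%N; last lia.
apply: cost_le_bind => [|r _ /=]; first exact: cost_sum_prog.
apply: cost_le_arith => d.
apply: cost_le_bind => [|m _ /=]; first exact: cost_count_prog.
by cost_tac.
Qed.

Lemma cost_solvable_prog s b : cost_le (solvable_prog s b) (5 * size s + 2).
Proof.
rewrite (_ : 5 * size s + 2 = 4 * size s + (size s + 2))%N; last lia.
apply: cost_le_literal => e.
apply: cost_le_bind => [|ts]; first exact: cost_TLs_prog.
(* Identifying [ts] as the mapped list shows that it is as long as [s], which bounds the
   summation. *)
rewrite TLs_progE => -[<-].
apply: cost_le_bind => [|r _ /=]; last by cost_tac.
by rewrite -(size_map (fun x => TL x e)); apply: cost_sum_prog.
Qed.

End Costs.

(** * Linear cost of each step of the algorithm *)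

Section Transitions.
Variables (R : realType) (n : nat) (a : n.-tuple R) (b : R).
Implicit Types (u : R) (J K : {set 'I_n}).

Lemma size_flags J : size (flags J) = n.
Proof. by rewrite size_map size_enum_ord. Qed.

Lemma cost_step1 : cost_le (transition a b Step1) (5 * n + 2).
Proof.
rewrite -[X in cost_le _ X]addn0; apply: cost_le_bind => [|t _].
  by apply: cost_le_weaken (cost_solvable_prog _ _) _; rewrite size_tuple.
exact: cost_le_ret.
Qed.

Lemma cost_step2 : cost_le (transition a b Step2) (2 * n + 3).
Proof.
rewrite -[X in cost_le _ X]addn0; apply: cost_le_bind => [|t _].
  by apply: cost_le_weaken (cost_candidate_prog _ _) _; rewrite size_tuple.
exact: cost_le_ret.
Qed.

Lemma size_selected J : (size [seq tnth a j | j <- enum J] <= n)%N.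
Proof. by rewrite size_map -cardE -[X in (_ <= X)%N]card_ord max_card. Qed.

Lemma cost_step3 u : cost_le (transition a b (Step3 u)) (8 * n + 2).
Proof.
(* In order: computing the set, selecting its entries, evaluating [TL], then summing, with one
   comparison and one branch. *)
rewrite (_ : 8 * n + 2 = 2 * n + (n + (4 * n + (n + 2))))%N; last lia.
apply: cost_le_bind => [|F].
  by apply: cost_le_weaken (cost_Jset_prog _ _) _; rewrite size_tuple.
rewrite Jset_progE => -[<-]; apply: cost_le_bind => [|s].
  by apply: cost_le_weaken (cost_select_prog _ _) _; rewrite size_tuple.
rewrite select_progE => -[<-]; have sn := size_selected (Jset a u).
apply: cost_le_bind => [|ts].
  by apply: cost_le_weaken (cost_TLs_prog _ _) _; rewrite leq_mul2l.
rewrite TLs_progE => -[<-]; apply: cost_le_bind => [|r _ /=].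
  by apply: cost_le_weaken (cost_sum_prog _) _; rewrite size_map.
apply: cost_le_compare => t; apply: cost_le_branch => t'.
exact: cost_le_ret.
Qed.

Lemma cost_step4 J : cost_le (transition a b (Step4 (flags J))) (3 * n + 3).
Proof.
rewrite (_ : 3 * n + 3 = n + (2 * n + 3 + 0))%N; last lia.
apply: cost_le_bind => [|s].
  by apply: cost_le_weaken (cost_select_prog _ _) _; rewrite size_tuple.
rewrite select_progE => -[<-]; apply: cost_le_bind => [|u _].
  apply: cost_le_weaken (cost_candidate_prog _ _) _.
  by rewrite leq_add2r leq_mul2l size_selected.
exact: cost_le_ret.
Qed.

Lemma cost_step5 u J : cost_le (transition a b (Step5 u (flags J))) (6 * n).
Proof.
rewrite (_ : 6 * n = 2 * n + (2 * n + 2 * n + 0))%N; last lia.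
apply: cost_le_bind => [|F].
  by apply: cost_le_weaken (cost_Jset_prog _ _) _; rewrite size_tuple.
rewrite Jset_progE => -[<-]; apply: cost_le_bind => [|t _].
  by apply: cost_le_weaken (cost_proper_prog _ _ _) _; rewrite !size_flags.
exact: cost_le_ret.
Qed.

(** * Termination and the total count *)

Definition halts_within (s : state R bool) (N : nat) : Prop :=
  exists m s' ops, [/\ run a b m s = Some (s', ops), halted s' & (ops <= N)%N].

Lemma halted_halts_within s N : halted s -> halts_within s N.
Proof. by move=> hs; exists 0%N, s, 0%N. Qed.

Lemma halts_within_weaken s N N' :
  halts_within s N -> (N <= N')%N -> halts_within s N'.
Proof.
move=> [m [s' [ops [hr hh ho]]]] le_N; exists m, s', ops; split=> //.
exact: leq_trans le_N.
Qed.

(** The equation on [result] rules out a stuck program, for which [cost_le] alone would say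
    nothing. *)
Lemma halts_within_step s s' k N :
  result (transition a b s) = Some s' -> cost_le (transition a b s) k ->
  halts_within s' N -> halts_within s (k + N).
Proof.
rewrite /result /cost_le; case e: (exec _) => [[z c]|] //= [<-] ck.
move=> [m [s'' [ops [hr hh ho]]]]; exists m.+1, s'', (c + ops)%N.
by rewrite /= e hr; split=> //; apply: leq_add.
Qed.

Lemma Jset_candidate_neq0 K :
  0 < b -> K != set0 ->
  Jset a ((b - \sum_(j in K) tnth a j) / #|K|%:R + 1) != set0.
Proof.
move=> b_gt0 K0; set u := (X in Jset a X); apply/eqP => Ju0.
(* If the new set were empty, every [tnth a j + u - 1] would be negative. *)
have : \sum_(j in K) (tnth a j + (u - 1)) <= 0.
  apply: sumr_le0 => j _.
  have : j \notin Jset a u by rewrite Ju0 inE.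
  by rewrite inE -ltNge ltrBrDr => /ltW; rewrite addrA subr_le0 addrC.
(* Multiplying [u - 1] by the nonzero [#|K|] cancels the division, so the sum equals [b], against
   [0 < b]. *)
rewrite big_split /= sumr_const /u addrK -[X in _ + X]mulr_natr divfK; last first.
  by rewrite pnatr_eq0 cards_eq0.
by rewrite addrC subrK leNgt b_gt0.
Qed.

(** One pass through Steps 4 and 5 costs at most [(3 * n + 3) + 6 * n]. Another pass starts from a
    proper subset, so there are at most [#|K|] passes. *)
Lemma step4_halts_within K :
  0 < b -> K != set0 ->
  halts_within (Step4 (flags K)) (#|K| * (9 * n + 3)).
Proof.
move=> b_gt0; have [k] := ubnP #|K|; elim: k K => // k IH K Kk K0.
have K_gt0 : (0 < #|K|)%N by rewrite card_gt0.
set u := (b - \sum_(j in K) tnth a j) / #|K|%:R + 1.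
(* The first pass is split off; the remaining [#|K|.-1] passes are left to the induction on
   cardinality. *)
apply: (@halts_within_weaken _ (3 * n + 3 + (6 * n + (#|K|.-1 * (9 * n + 3))))%N);
  last by rewrite -[X in (_ <= X * _)%N](prednK K_gt0) mulSn; lia.
apply: (halts_within_step (transition_step4 _ _ K0) (@cost_step4 K)).
apply: (halts_within_step (transition_step5 a b u K) (@cost_step5 u K)).
case: ifP => [/proper_card lt_JK|_]; last first.
  exact: halted_halts_within.
apply: halts_within_weaken (IH _ _ _) _.
- by rewrite (leq_trans lt_JK) // -ltnS.
- exact: Jset_candidate_neq0.
- by rewrite leq_mul2r -ltnS prednK // lt_JK orbT.
Qed.

End Transitions.

Theorem theorem5p6 (R : realType) :
  exists C : nat, forall (n : nat) (a : n.-tuple R) (b : R),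
    (0 < n)%N ->
    (forall j : 'I_n, 0 <= tnth a j <= 1) ->
    0 < b ->
    exists (m : nat) (s : state R bool) (ops : nat),
      [/\ run a b m Step1 = Some (s, ops), halted s & (ops <= C * n ^ 2)%N].
Proof.
(* The steps add up to [9 * n ^ 2 + 18 * n + 7], and [9 + 18 + 7 = 34] suffices since [n >= 1]. *)
exists 34%N => n a b n_gt0 _ b_gt0; rewrite -/(halts_within a b Step1 _).
apply: (@halts_within_weaken _ _ _ _ _ (5 * n + 2 +
  (2 * n + 3 + (8 * n + 2 + n * (9 * n + 3))))%N); last by nia.
have [t step1 _] := transition_step1 a b.
apply: (halts_within_step step1 (@cost_step1 _ _ a b)).
case: t {step1}; last exact: halted_halts_within.
apply: (halts_within_step (transition_step2 _ _ n_gt0) (@cost_step2 _ _ a b)).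
set u := _ + 1.
apply: (halts_within_step (transition_step3 a b u) (@cost_step3 _ _ a b u)).
case: ifP => _; first exact: halted_halts_within.
(* Step 2 is the formula of Step 4 for the whole index set, nonempty because [0 < n], so the first
   stored set is nonempty too. *)
have Ju0 : Jset a u != set0.
  have := @Jset_candidate_neq0 _ _ a b [set: 'I_n] b_gt0.
  rewrite cardsT card_ord (eq_bigl predT) => [|j]; last by rewrite inE.
  by apply; rewrite -cards_eq0 cardsT card_ord -lt0n.
apply: halts_within_weaken (step4_halts_within _ b_gt0 Ju0) _.
by rewrite leq_mul2r -[X in (_ <= X)%N]card_ord max_card orbT.
Qed.
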